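(* For every rational $\varepsilon \ge 0$, the (unconstrained) $\varepsilon$-ETR decision problem and the ETR decision problem are polynomial-time reducible to each other (in the Turing/bit model). In other words, $\varepsilon$-ETR $=$ ETR, where ETR denotes the class of problems polynomial-time reducible to the ETR decision problem.
   Context: The ETR decision problem: given a Boolean formula $F$ built with connectives $\land,\lor,\lnot$ from atoms of the form $p(x)\bowtie p'(x)$, where $p,p'$ are multivariate polynomials with rational coefficients in real variables $x=(x_1,\dots,x_q)$ and $\bowtie\in\{<,\le,=,\ge,>\}$, decide whether $\exists x\in\mathbb{R}^q$ with $F(x)$ true. For $\varepsilon\ge 0$ define relaxed comparison operators: $a<_\varepsilon b$ iff $a<b+\varepsilon$; $a\le_\varepsilon b$ iff $a\le b+\varepsilon$; $a>_\varepsilon b$ iff $a>b-\varepsilon$; $a\ge_\varepsilon b$ iff $a\ge b-\varepsilon$. An $\varepsilon$-ETR formula is a negation-free Boolean formula (connectives $\land,\lor$ only) whose atoms compare multivariate polynomials with rational coefficients using only the operators $<_\varepsilon,\le_\varepsilon,\ge_\varepsilon,>_\varepsilon$ (equalities are not allowed; an equality $a=b$ is expressed as $(a\le_\varepsilon b)\land(b\le_\varepsilon a)$). The (unconstrained) $\varepsilon$-ETR decision problem: given such a formula $F$ over variables $x\in\mathbb{R}^q$, decide whether there exists $x\in\mathbb{R}^q$ satisfying $F$. *)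

(* Defs.v *)
From Corelib Require Import BinNums.
From HB Require Import structures.
From mathcomp Require Import all_boot all_order all_algebra.
From mathcomp Require Import reals.
From mathcomp Require Import mpoly.
Set Implicit Arguments.
Unset Strict Implicit.
Unset Printing Implicit Defensive.
Import Order.TTheory GRing.Theory Num.Theory.

Local Open Scope ring_scope.

(** * Multitape Turing machines *)

Inductive direction := MoveL | MoveN | MoveR.

Inductive tape_id (W : Type) := InTape | OutTape | WorkTape of W.
Arguments InTape {W}.
Arguments OutTape {W}.

(* Deterministic machines from words over A to words over B, with finitely
   many states, tape symbols and work tapes.  A cell holds [None] when blank. *)
Record TM (A B : finType) := MkTM {
  tm_state : finType;
  tm_sym : finType;
  tm_work : finType;
  tm_in : A -> tm_sym;
  tm_in_inj : injective tm_in;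
  tm_out : B -> tm_sym;
  tm_out_inj : injective tm_out;
  tm_start : tm_state;
  tm_halt : pred tm_state;
  tm_trans : tm_state -> (tape_id tm_work -> option tm_sym) ->
             tm_state * (tape_id tm_work -> option tm_sym * direction)
}.

(* A two-way infinite tape, indexed relatively to the head: the scanned cell
   is cell 0. *)
Definition tape (S : Type) := int -> option S.

Definition write_move (S : Type) (t : tape S) (a : option S * direction) :
    tape S :=
  let t' := fun i => if i == 0 then a.1 else t i in
  match a.2 with
  | MoveL => fun i => t' (i - 1)
  | MoveN => t'
  | MoveR => fun i => t' (i + 1)
  end.

Definition blank_tape (S : Type) : tape S := fun _ => None.

(* The word w on an otherwise blank tape, with the head on its first letter. *)
Definition word_tape (S : Type) (w : seq S) : tape S :=
  fun i => if i is Posz n then onth w n else None.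

Section Run.
Variables (A B : finType) (M : TM A B).

Record config := MkConfig {
  cf_state : tm_state M;
  cf_tape : tape_id (tm_work M) -> tape (tm_sym M)
}.

Definition init_config (w : seq A) : config :=
  MkConfig (tm_start M) (fun j =>
    if j is InTape then word_tape (map (@tm_in _ _ M) w)
    else @blank_tape _).

Definition tm_step (c : config) : config :=
  if tm_halt (cf_state c) then c else
  let a := tm_trans (cf_state c) (fun j => cf_tape c j 0) in
  MkConfig a.1 (fun j => write_move (cf_tape c j) (a.2 j)).

Definition outputs_within (w : seq A) (v : seq B) (t : nat) : Prop :=
  let c := iter t tm_step (init_config w) in
  tm_halt (cf_state c) /\
  cf_tape c OutTape =1 word_tape (map (@tm_out _ _ M) v).

End Run.

(** * Decision problems and polynomial-time many-one reductions *)

Record problem := MkProblem {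
  alphabet : finType;
  instance : Type;
  encode : instance -> seq alphabet;
  encode_inj : injective encode;
  yes : instance -> Prop
}.

Definition polytime_computable (P Q : problem) (f : instance P -> instance Q) :
    Prop :=
  exists (M : TM (alphabet P) (alphabet Q)) (c k : nat),
    forall x : instance P,
      outputs_within M (encode x) (encode (f x))
        (c * size (encode x) ^ k + c)%N.

Definition polytime_reducible (P Q : problem) : Prop :=
  exists f : instance P -> instance Q,
    polytime_computable f /\ forall x, yes x <-> yes (f x).

Definition class_of (Q : problem) : problem -> Prop :=
  fun P => polytime_reducible P Q.

(** * Formulas *)

(* The sparse presentation of a polynomial in q variables: a list of terms
   c * x_i1^e1 * ... * x_ik^ek, with repetitions allowed. *)
Definition monom (q : nat) := seq ('I_q * nat).
Definition spoly (q : nat) := seq (rat * monom q).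

Definition mpoly_of (q : nat) (p : spoly q) : {mpoly rat[q]} :=
  \sum_(t <- p) t.1 *: \prod_(v <- t.2) 'X_(v.1) ^+ v.2.

Lemma mpoly_of_surj (q : nat) (P : {mpoly rat[q]}) : exists p, mpoly_of p = P.
Proof.
exists [seq (P@_m, [seq (i, m i) | i <- enum 'I_q]) | m <- msupp P].
rewrite [RHS]mpolyE /mpoly_of big_map; apply: eq_bigr => m _ /=.
by rewrite mpolyXE_id big_map big_enum.
Qed.

Definition spoly_eval (R : realType) (q : nat) (x : 'I_q -> R) (p : spoly q) :
    R :=
  (map_mpoly (@ratr R) (mpoly_of p)).@[x].

Inductive cmp := CLt | CLe | CEq | CGe | CGt.

Definition cmp_holds (R : realType) (r : cmp) (a b : R) : bool :=
  match r with
  | CLt => a < b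
  | CLe => a <= b
  | CEq => a == b
  | CGe => a >= b
  | CGt => a > b
  end.

Inductive formula (q : nat) :=
  | FAtom of cmp & spoly q & spoly q
  | FAnd of formula q & formula q
  | FOr of formula q & formula q
  | FNot of formula q.

Fixpoint holds (R : realType) (q : nat) (x : 'I_q -> R) (F : formula q) :
    Prop :=
  match F with
  | FAtom r p p' => cmp_holds r (spoly_eval x p) (spoly_eval x p')
  | FAnd F1 F2 => holds x F1 /\ holds x F2
  | FOr F1 F2 => holds x F1 \/ holds x F2
  | FNot F1 => ~ holds x F1
  end.

Inductive eps_cmp := LtE | LeE | GeE | GtE.

Definition eps_cmp_holds (R : realType) (eps : R) (r : eps_cmp) (a b : R) :
    bool :=
  match r with
  | LtE => a < b + eps
  | LeE => a <= b + eps
  | GeE => a >= b - eps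
  | GtE => a > b - eps
  end.

Inductive eps_formula (q : nat) :=
  | EAtom of eps_cmp & spoly q & spoly q
  | EAnd of eps_formula q & eps_formula q
  | EOr of eps_formula q & eps_formula q.

Fixpoint eps_holds (R : realType) (eps : R) (q : nat) (x : 'I_q -> R)
    (F : eps_formula q) : Prop :=
  match F with
  | EAtom r p p' => eps_cmp_holds eps r (spoly_eval x p) (spoly_eval x p')
  | EAnd F1 F2 => eps_holds eps x F1 /\ eps_holds eps x F2
  | EOr F1 F2 => eps_holds eps x F1 \/ eps_holds eps x F2
  end.

(** * Encoding of formulas as words *)

Inductive symbol :=
  | SBit0 | SBit1 | SNumEnd | SMinus
  | STimes | SMonEnd | SPlus | SPolyEnd
  | SAnd | SOr | SNot
  | SLt | SLe | SEq | SGe | SGt.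

Definition symbols : seq symbol :=
  [:: SBit0; SBit1; SNumEnd; SMinus; STimes; SMonEnd; SPlus; SPolyEnd;
      SAnd; SOr; SNot; SLt; SLe; SEq; SGe; SGt].

Definition symbol_code (s : symbol) : nat :=
  match s with
  | SBit0 => 0 | SBit1 => 1 | SNumEnd => 2 | SMinus => 3
  | STimes => 4 | SMonEnd => 5 | SPlus => 6 | SPolyEnd => 7
  | SAnd => 8 | SOr => 9 | SNot => 10
  | SLt => 11 | SLe => 12 | SEq => 13 | SGe => 14 | SGt => 15
  end%N.

Lemma symbol_codeK : pcancel symbol_code (onth symbols).
Proof. by case. Qed.

HB.instance Definition _ := Countable.copy symbol (pcan_type symbol_codeK).

Lemma symbols_enum : Finite.axiom symbols.
Proof. by case. Qed.

HB.instance Definition _ := isFinite.Build symbol symbols_enum.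

(* Numbers are written in binary, least significant bit first; 0 has no bits. *)
Fixpoint pos_bits (p : positive) : seq symbol :=
  match p with
  | xH => [:: SBit1]
  | xO p' => SBit0 :: pos_bits p'
  | xI p' => SBit1 :: pos_bits p'
  end.

Definition enc_nat (n : nat) : seq symbol :=
  (if bin_of_nat n is Npos p then pos_bits p else [::]) ++ [:: SNumEnd].

Definition enc_int (z : int) : seq symbol :=
  (if z < 0 then [:: SMinus] else [::]) ++ enc_nat `|z|%N.

Definition enc_rat (c : rat) : seq symbol :=
  enc_int (numq c) ++ enc_nat `|denq c|%N.

Fixpoint enc_seq (T : Type) (item stop : symbol) (enc : T -> seq symbol)
    (s : seq T) : seq symbol :=
  if s is x :: s' then item :: enc x ++ enc_seq item stop enc s'
  else [:: stop].

Definition enc_factor (q : nat) (v : 'I_q * nat) : seq symbol :=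
  enc_nat v.1 ++ enc_nat v.2.

Definition enc_term (q : nat) (t : rat * monom q) : seq symbol :=
  enc_rat t.1 ++ enc_seq STimes SMonEnd (@enc_factor q) t.2.

Definition enc_spoly (q : nat) (p : spoly q) : seq symbol :=
  enc_seq SPlus SPolyEnd (@enc_term q) p.

Definition enc_cmp (r : cmp) : symbol :=
  match r with
  | CLt => SLt | CLe => SLe | CEq => SEq | CGe => SGe | CGt => SGt
  end.

Definition enc_eps_cmp (r : eps_cmp) : symbol :=
  match r with LtE => SLt | LeE => SLe | GeE => SGe | GtE => SGt end.

(* Formulas are written in prefix notation. *)
Fixpoint enc_formula (q : nat) (F : formula q) : seq symbol :=
  match F with
  | FAtom r p p' => enc_cmp r :: enc_spoly p ++ enc_spoly p'
  | FAnd F1 F2 => SAnd :: enc_formula F1 ++ enc_formula F2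
  | FOr F1 F2 => SOr :: enc_formula F1 ++ enc_formula F2
  | FNot F1 => SNot :: enc_formula F1
  end.

Fixpoint enc_eps_formula (q : nat) (F : eps_formula q) : seq symbol :=
  match F with
  | EAtom r p p' => enc_eps_cmp r :: enc_spoly p ++ enc_spoly p'
  | EAnd F1 F2 => SAnd :: enc_eps_formula F1 ++ enc_eps_formula F2
  | EOr F1 F2 => SOr :: enc_eps_formula F1 ++ enc_eps_formula F2
  end.

Definition etr_instance := {q : nat & formula q}.
Definition eps_etr_instance := {q : nat & eps_formula q}.

Definition enc_etr (I : etr_instance) : seq symbol :=
  enc_nat (tag I) ++ enc_formula (tagged I).

Definition enc_eps_etr (I : eps_etr_instance) : seq symbol :=
  enc_nat (tag I) ++ enc_eps_formula (tagged I).

Definition prefix_free (T : Type) (enc : T -> seq symbol) :=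
  forall x y s t, enc x ++ s = enc y ++ t -> x = y /\ s = t.

Lemma prefix_free_inj (T : Type) (enc : T -> seq symbol) :
  prefix_free enc -> injective enc.
Proof. by move=> pf x y exy; case: (pf x y [::] [::]); rewrite ?exy. Qed.

Lemma pos_bits_pf p p' s t :
  pos_bits p ++ SNumEnd :: s = pos_bits p' ++ SNumEnd :: t ->
  p = p' /\ s = t.
Proof.
elim: p p' => [p IH|p IH|] [p'|p'|] //= [].
- by move/IH => [-> ->].
- by case: p {IH}.
- by move/IH => [-> ->].
- by case: p'.
- by move=> ->.
Qed.

Lemma enc_nat_pf : prefix_free enc_nat.
Proof.
move=> m n s t; rewrite /enc_nat -!catA /= => E.
suff [e ->] : bin_of_nat m = bin_of_nat n /\ s = t.
  by split=> //; rewrite -(bin_of_natK m) e bin_of_natK.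
case: (bin_of_nat m) (bin_of_nat n) E => [|p] [|p'] //=.
- by case=> ->.
- by case: p'.
- by case: p.
- by move/pos_bits_pf => [-> ->].
Qed.

Lemma enc_natNminus n s t : enc_nat n ++ s <> SMinus :: t.
Proof. by rewrite /enc_nat; case: (bin_of_nat n) => [|[]]. Qed.

Lemma enc_int_pf : prefix_free enc_int.
Proof.
move=> y z s t; rewrite /enc_int.
case: (ltP y 0) => y0; case: (ltP z 0) => z0;
  rewrite -!(catA _ (enc_nat _)).
- move=> [] /enc_nat_pf [e ->]; split=> //.
  by apply: oppr_inj; rewrite -(ltr0_norm y0) -(ltr0_norm z0) -!abszE e.
- by move/esym/enc_natNminus.
- by move/enc_natNminus.
- move=> /enc_nat_pf [e ->]; split=> //.
  by rewrite -(ger0_norm y0) -(ger0_norm z0) -!abszE e.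
Qed.

Lemma enc_rat_pf : prefix_free enc_rat.
Proof.
move=> x y s t; rewrite /enc_rat -!(catA (enc_int _)).
move=> /enc_int_pf [en /enc_nat_pf [ed ->]].
split=> //; rewrite -(divq_num_den x) -(divq_num_den y) en.
by rewrite -(gtz0_abs (denq_gt0 x)) -(gtz0_abs (denq_gt0 y)) ed.
Qed.

Lemma enc_seq_pf (T : Type) (item stop : symbol) (enc : T -> seq symbol) :
  item <> stop -> prefix_free enc -> prefix_free (enc_seq item stop enc).
Proof.
move=> ne pf; elim=> [|x u IH] [|y v] s t //=.
- by case=> ->.
- by case=> e; case: ne.
- by case=> e; case: ne.
- by rewrite -!catA => -[] /pf [-> /IH [-> ->]].
Qed.

Lemma enc_factor_pf q : prefix_free (@enc_factor q).
Proof.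
move=> [i e] [j f] s t; rewrite /enc_factor -!(catA (enc_nat _)) /=.
by move=> /enc_nat_pf [/val_inj -> /enc_nat_pf [-> ->]].
Qed.

Lemma enc_term_pf q : prefix_free (@enc_term q).
Proof.
move=> [c m] [d n] s t; rewrite /enc_term -!(catA (enc_rat _)) /= => /enc_rat_pf [-> E].
by have [|-> ->] := enc_seq_pf _ (@enc_factor_pf q) E.
Qed.

Lemma enc_spoly_pf q : prefix_free (@enc_spoly q).
Proof. by apply: enc_seq_pf => //; apply: enc_term_pf. Qed.

Lemma enc_formula_pf q : prefix_free (@enc_formula q).
Proof.
elim=> [r p p'|F1 IH1 F2 IH2|F1 IH1 F2 IH2|F1 IH1]
  [r' p1 p1'|G1 G2|G1 G2|G1] s t /=; rewrite -?catA.
all: try by case: r.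
all: try by case: r'.
all: try by [].
- case=> er /enc_spoly_pf [-> /enc_spoly_pf [-> ->]].
  by split=> //; congr FAtom; case: r r' er => [] [].
- by case=> /IH1 [-> /IH2 [-> ->]].
- by case=> /IH1 [-> /IH2 [-> ->]].
- by case=> /IH1 [-> ->].
Qed.

Lemma enc_eps_formula_pf q : prefix_free (@enc_eps_formula q).
Proof.
elim=> [r p p'|F1 IH1 F2 IH2|F1 IH1 F2 IH2]
  [r' p1 p1'|G1 G2|G1 G2] s t /=; rewrite -?catA.
all: try by case: r.
all: try by case: r'.
all: try by [].
- case=> er /enc_spoly_pf [-> /enc_spoly_pf [-> ->]].
  by split=> //; congr EAtom; case: r r' er => [] [].
- by case=> /IH1 [-> /IH2 [-> ->]].
- by case=> /IH1 [-> /IH2 [-> ->]].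
Qed.

Lemma enc_etr_inj : injective enc_etr.
Proof.
move=> [q F] [q' G]; rewrite /enc_etr /= => /enc_nat_pf [e].
by case: q' / e G => G /(prefix_free_inj (@enc_formula_pf q)) ->.
Qed.

Lemma enc_eps_etr_inj : injective enc_eps_etr.
Proof.
move=> [q F] [q' G]; rewrite /enc_eps_etr /= => /enc_nat_pf [e].
by case: q' / e G => G /(prefix_free_inj (@enc_eps_formula_pf q)) ->.
Qed.

(** * The two decision problems *)

Definition ETR (R : realType) : problem :=
  MkProblem enc_etr_inj
    (fun I => exists x : 'I_(tag I) -> R, holds x (tagged I)).

Definition EpsETR (R : realType) (eps : rat) : problem :=
  MkProblem enc_eps_etr_inj
    (fun I => exists x : 'I_(tag I) -> R, eps_holds (ratr eps) x (tagged I)).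

(* Main.v *)
(** With polynomials as operands a relaxed comparison and an exact one differ by
    a rational constant: [a <_eps b] is [a - eps < b], and [a < b] is
    [a + eps <_eps b].  Going from eps-ETR to ETR is therefore a letter-to-word
    substitution, inserting a constant term after each comparison symbol.  The
    converse also has to remove negations and equalities: a pushdown transducer
    reads the prefix notation while keeping on its stack the polarities of the
    pending right subformulas, and copies each atom twice, [a = b] becoming
    [a <= b] and [a >= b].  Both transducers take a linear number of steps, and
    the equality of the classes follows by composing reductions. *)

Require Import Defs.
From HB Require Import structures.
From mathcomp Require Import all_boot all_order all_algebra.
From mathcomp Require Import boolp reals.
From mathcomp Require Import mpoly.
From mathcomp Require Import zify.
Set Implicit Arguments.
Unset Strict Implicit.
Unset Printing Implicit Defensive.
Import Order.TTheory GRing.Theory Num.Theory.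

Local Open Scope ring_scope.

(** * Turing machines *)

Lemma word_tape_map (S T : Type) (f : S -> T) (w : seq S) i :
  word_tape (map f w) i = omap f (word_tape w i).
Proof. by case: i => //= n; rewrite onth_map. Qed.

Lemma write_move_id (S : Type) (t : tape S) : write_move t (t 0, MoveN) = t.
Proof. by apply: funext => i; rewrite /write_move /=; case: eqP => [->|]. Qed.

Lemma write_move_omap (S T : Type) (f : option S -> option T)
    (t : tape S) (u : tape T) (a : option S * direction) :
  (forall i, f (t i) = u i) ->
  forall i, f (write_move t a i) = write_move u (f a.1, a.2) i.
Proof. by case: a => a [] tu i; rewrite /write_move /=; case: eqP. Qed.

Section Runs.
Variables (A B : finType) (M : TM A B).

Lemma iter_halted n (c : config M) :
  tm_halt (cf_state c) -> iter n (@tm_step _ _ M) c = c.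
Proof. by move=> halted; rewrite iter_fix // /tm_step halted. Qed.

Lemma outputs_within_mono w v t t' :
  (t <= t')%N -> outputs_within M w v t -> outputs_within M w v t'.
Proof.
by move=> /subnK <- [halted out]; rewrite /outputs_within iterD iter_halted.
Qed.

Lemma write_move_support (S : Type) (t : tape S) (a : option S * direction) m :
  (forall i, (m < `|i|)%N -> t i = None) ->
  forall i, (m.+1 < `|i|)%N -> write_move t a i = None.
Proof.
move=> t_supp i lt_mi; case: a => x []; rewrite /write_move /=; case: eqP => ei;
  by [lia | apply: t_supp; lia].
Qed.

Lemma run_support w j m i : j <> InTape -> (m < `|i|)%N ->
  cf_tape (iter m (@tm_step _ _ M) (init_config M w)) j i = None.
Proof.
move=> jNin; elim: m i => [|m IH] i lt_mi; first by case: j jNin.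
rewrite iterS /tm_step; case: ifP => _ /=; first by apply: IH; lia.
exact: write_move_support IH i lt_mi.
Qed.

Lemma size_output w v t : outputs_within M w v t -> (size v <= t.+1)%N.
Proof.
case=> _ out; rewrite leqNgt; apply/negP => lt_tv.
have := out (Posz t.+1); rewrite run_support // /word_tape.
by move/esym/(congr1 isSome); rewrite onthTE size_map lt_tv.
Qed.

End Runs.

(** * Composition of reductions *)

Section Composition.
Variables (A B C : finType) (M1 : TM A B) (M2 : TM B C).

Let sym := (tm_sym M1 + tm_sym M2)%type.
Let work := ((tm_work M1 + tm_work M2) + unit)%type.

Definition first_tape (j : tape_id (tm_work M1)) : tape_id work :=
  match j with
  | InTape => InTape
  | OutTape => WorkTape (inr tt)
  | WorkTape v => WorkTape (inl (inl v))
  end.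

Definition second_tape (j : tape_id (tm_work M2)) : tape_id work :=
  match j with
  | InTape => WorkTape (inr tt)
  | OutTape => OutTape
  | WorkTape v => WorkTape (inl (inr v))
  end.

(* The intermediate tape is left to the second machine in the symbols of the
   first one, which are translated when they are read. *)
Definition first_read (s : option sym) : option (tm_sym M1) :=
  if s is Some (inl a) then Some a else None.

Definition second_read (s : option sym) : option (tm_sym M2) :=
  match s with
  | Some (inr a) => Some a
  | Some (inl a) => omap (@tm_in _ _ M2) [pick b | tm_out M1 b == a]
  | None => None
  end.

Definition comp_trans (s : tm_state M1 + tm_state M2)
    (rd : tape_id work -> option sym) :
    (tm_state M1 + tm_state M2) * (tape_id work -> option sym * direction) :=
  match s with
  | inl s1 =>
    if tm_halt s1 then (inr (tm_start M2), fun j => (rd j, MoveN)) else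
    let a := tm_trans s1 (fun j => first_read (rd (first_tape j))) in
    let wr j := (omap inl (a.2 j).1, (a.2 j).2) in
    (inl a.1, fun j =>
      match j with
      | InTape => wr InTape
      | OutTape => (rd j, MoveN)
      | WorkTape (inl (inl v)) => wr (WorkTape v)
      | WorkTape (inl (inr _)) => (rd j, MoveN)
      | WorkTape (inr _) => wr OutTape
      end)
  | inr s2 =>
    let a := tm_trans s2 (fun j => second_read (rd (second_tape j))) in
    let wr j := (omap inr (a.2 j).1, (a.2 j).2) in
    (inr a.1, fun j =>
      match j with
      | InTape => (rd j, MoveN)
      | OutTape => wr OutTape
      | WorkTape (inl (inl _)) => (rd j, MoveN)
      | WorkTape (inl (inr v)) => wr (WorkTape v)
      | WorkTape (inr _) => wr InTape
      end)
  end.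

Lemma comp_in_inj : injective (fun a => inl (tm_in M1 a) : sym).
Proof. by move=> x y [] /tm_in_inj. Qed.

Lemma comp_out_inj : injective (fun c => inr (tm_out M2 c) : sym).
Proof. by move=> x y [] /tm_out_inj. Qed.

Definition comp_tm : TM A C :=
  @MkTM A C (tm_state M1 + tm_state M2)%type sym work _ comp_in_inj
    _ comp_out_inj (inl (tm_start M1))
    (fun s => if s is inr s2 then tm_halt s2 else false) comp_trans.

Definition simulates_first (d : config comp_tm) (c : config M1) :=
  [/\ cf_state d = inl (cf_state c),
      forall j i, cf_tape d (first_tape j) i = omap inl (cf_tape c j i),
      forall i, cf_tape d OutTape i = None &
      forall v i, cf_tape d (WorkTape (inl (inr v))) i = None].

Definition simulates_second (d : config comp_tm) (c : config M2) :=
  [/\ cf_state d = inr (cf_state c),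
      forall j i, second_read (cf_tape d (second_tape j) i) = cf_tape c j i &
      forall i, cf_tape d OutTape i = omap inr (cf_tape c OutTape i)].

Lemma simulates_first_init w :
  simulates_first (init_config comp_tm w) (init_config M1 w).
Proof.
split=> // -[||v] i //=.
by rewrite (map_comp inl) word_tape_map.
Qed.

Lemma simulates_first_step d c :
  ~~ tm_halt (cf_state c) -> simulates_first d c ->
  simulates_first (tm_step d) (tm_step c).
Proof.
move=> running [state_d tape_d out_d work_d].
rewrite /tm_step /= state_d (negPf running) /= (negPf running).
have -> : (fun j => first_read (cf_tape d (first_tape j) 0)) =
          (fun j => cf_tape c j 0).
  by apply: funext => j; rewrite tape_d; case: (cf_tape c j 0).
split=> //=.
- by move=> j i; apply/esym; case: j => [||v] /=;
    apply: write_move_omap => k;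
    rewrite -(tape_d, tape_d OutTape, tape_d (WorkTape _)).
- by move=> i; rewrite write_move_id.
- by move=> v i; rewrite write_move_id.
Qed.

Lemma simulates_first_run n d c : simulates_first d c ->
  tm_halt (cf_state (iter n (@tm_step _ _ M1) c)) ->
  exists2 m, (m <= n)%N &
    simulates_first (iter m (@tm_step _ _ comp_tm) d)
                    (iter n (@tm_step _ _ M1) c).
Proof.
elim: n d c => [|n IH] d c sim; first by exists 0%N.
case: (boolP (tm_halt (cf_state c))) => [halted _|running].
  by rewrite iter_halted //; exists 0%N.
rewrite iterSr => /(IH _ _ (simulates_first_step running sim)) [m le_mn sim_m].
by exists m.+1; rewrite ?iterSr.
Qed.

Lemma simulates_handover d c u : simulates_first d c -> tm_halt (cf_state c) ->
  cf_tape c OutTape =1 word_tape (map (@tm_out _ _ M1) u) ->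
  simulates_second (tm_step d) (init_config M2 u).
Proof.
move=> [state_d tape_d out_d work_d] halted out.
rewrite /tm_step /= state_d /= halted; split=> //=.
- case=> [||v] i /=; rewrite write_move_id ?out_d ?work_d //.
  rewrite (tape_d OutTape) out !word_tape_map; case: (word_tape u i) => //= b.
  by case: pickP => [b' /eqP/tm_out_inj -> //|/(_ b)]; rewrite eqxx.
- by move=> i; rewrite write_move_id.
Qed.

Lemma simulates_second_step d c : simulates_second d c ->
  simulates_second (tm_step d) (tm_step c).
Proof.
move=> [state_d tape_d out_d].
rewrite /tm_step /= state_d /=; case: ifP => // _ /=.
have -> : (fun j => second_read (cf_tape d (second_tape j) 0)) =
          (fun j => cf_tape c j 0).
  by apply: funext => j; rewrite tape_d.
have read_inr x : second_read (omap inr x) = x by case: x.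
split=> //=.
- case=> [||v] i; rewrite (write_move_omap _ (tape_d _)) /= read_inr;
    by rewrite -surjective_pairing.
- by move=> i; apply/esym/write_move_omap => k; rewrite out_d.
Qed.

Lemma simulates_second_run n d c : simulates_second d c ->
  simulates_second (iter n (@tm_step _ _ comp_tm) d)
                   (iter n (@tm_step _ _ M2) c).
Proof. by elim: n => // n IH sim; apply/simulates_second_step/IH. Qed.

Lemma comp_outputs_within w u v t1 t2 :
  outputs_within M1 w u t1 -> outputs_within M2 u v t2 ->
  outputs_within comp_tm w v (t1 + t2.+1).
Proof.
move=> [halted1 out1] [halted2 out2].
have [m le_mt1 sim_first] :=
  simulates_first_run (simulates_first_init w) halted1.
have [state_d _ out_d] :=
  simulates_second_run t2 (simulates_handover sim_first halted1 out1).
apply: (@outputs_within_mono _ _ _ _ _ (t2.+1 + m)%N).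
  by rewrite addnC leq_add2r.
rewrite /outputs_within iterD iterSr state_d; split=> // i.
by rewrite out_d out2 -word_tape_map -map_comp.
Qed.

End Composition.

Lemma leq_expn2r m n k : (m <= n)%N -> (m ^ k <= n ^ k)%N.
Proof. by case: k => // k le_mn; rewrite leq_exp2r. Qed.

Lemma exp_succ_le n k : (n.+1 ^ k <= 2 ^ k * (n ^ k + 1))%N.
Proof.
case: n => [|n]; first by rewrite exp1n muln_gt0 expn_gt0 addn1.
rewrite mulnDr -expnMn; apply: leq_trans (leq_addr _ _).
by rewrite leq_expn2r // mul2n -addnn addSnnS leq_addl.
Qed.

(* Unlike [c * n ^ k + c], the bound [c * n.+1 ^ k] is stable by composition. *)
Lemma polytime_computableP (P Q : problem) (f : instance P -> instance Q) :
  polytime_computable f <->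
  exists (M : TM (alphabet P) (alphabet Q)) (c k : nat), forall x,
    outputs_within M (encode x) (encode (f x))
      (c * (size (encode x)).+1 ^ k)%N.
Proof.
split=> -[M [c [k within]]].
- exists M, (2 * c)%N, k => x; apply: outputs_within_mono (within x).
  have le_exp := leq_expn2r k (leqnSn (size (encode x))).
  have pos_exp : (0 < (size (encode x)).+1 ^ k)%N by rewrite expn_gt0.
  by nia.
- exists M, (c * 2 ^ k)%N, k => x; apply: outputs_within_mono (within x).
  rewrite -[X in (_ <= _ + X)%N]muln1 -mulnDr -mulnA leq_mul2l.
  by rewrite exp_succ_le orbT.
Qed.

Lemma polytime_computable_comp (P Q S : problem)
    (f : instance P -> instance Q) (g : instance Q -> instance S) :
  polytime_computable f -> polytime_computable g ->
  polytime_computable (g \o f).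
Proof.
move=> /polytime_computableP [M1 [c1 [k1 within1]]].
move=> /polytime_computableP [M2 [c2 [k2 within2]]].
apply/polytime_computableP.
exists (comp_tm M1 M2), (c1 + (c2 * (c1 + 2) ^ k2).+1)%N, (k1 + k1 * k2)%N => x.
apply: outputs_within_mono (comp_outputs_within (within1 x) (within2 (f x))).
have := size_output (within1 x).
set N := size (encode (f x)); set n := (size (encode x)).+1 => le_N.
have pos_exp k : (0 < n ^ k)%N by rewrite expn_gt0.
have le_time2 : (N.+1 ^ k2 <= (c1 + 2) ^ k2 * n ^ (k1 * k2))%N.
  by rewrite expnM -expnMn leq_expn2r //; have := pos_exp k1; nia.
rewrite mulnDl leq_add //.
  by rewrite leq_mul2l expnD leq_pmulr ?orbT.
rewrite expnD; have := leq_mul (leqnn c2) le_time2; rewrite mulnA.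
by have := pos_exp k1; have := pos_exp (k1 * k2)%N; nia.
Qed.

Lemma polytime_reducible_trans (P Q S : problem) :
  polytime_reducible P Q -> polytime_reducible Q S -> polytime_reducible P S.
Proof.
move=> [f [f_poly yes_f]] [g [g_poly yes_g]]; exists (g \o f); split.
  exact: polytime_computable_comp.
by move=> x; rewrite yes_f yes_g.
Qed.

(** * Tapes as words around the head *)

Section Tapes.
Variable S : Type.
Implicit Types (t : tape S) (u v : seq S) (a : S) (d : direction).

Definition move_head d t : tape S := write_move t (t 0, d).

Definition offset d : int :=
  match d with MoveL => -1 | MoveN => 0 | MoveR => 1 end.

Lemma move_headE d t i : move_head d t i = t (i + offset d).
Proof.
by case: d; rewrite /move_head /write_move /= ?addr0; case: eqP => [->|].
Qed.

Lemma write_moveE t x d :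
  write_move t (x, d) = move_head d (write_move t (x, MoveN)).
Proof. by case: d; apply: funext => i; rewrite move_headE /= ?addr0. Qed.

Lemma move_headLK : cancel (move_head MoveL) (move_head MoveR).
Proof. by move=> t; apply: funext => i; rewrite !move_headE addrK. Qed.

(* The word [rev u ++ v] with the head on the first letter of [v]. *)
Definition zipper u v : tape S :=
  fun i => match i with Posz n => onth v n | Negz n => onth u n end.

Lemma word_zipper v : word_tape v = zipper [::] v.
Proof. by apply: funext => -[n|n]; rewrite /= ?onth0n. Qed.

Lemma blank_zipper : @blank_tape S = zipper [::] [::].
Proof. by apply: funext => -[n|n]; rewrite /= onth0n. Qed.

Lemma zipper_moveL u a v :
  move_head MoveL (zipper (a :: u) v) = zipper u (a :: v).
Proof.
apply: funext => i; rewrite move_headE /offset.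
case: i => [[|n]|n].
- by [].
- have -> : Posz n.+1 - 1 = n by lia.
  by [].
- have -> : Negz n - 1 = Negz n.+1 by lia.
  by [].
Qed.

Lemma zipper_moveR u a v :
  move_head MoveR (zipper u (a :: v)) = zipper (a :: u) v.
Proof. by rewrite -zipper_moveL move_headLK. Qed.

Lemma zipper_write u a :
  write_move (zipper u [::]) (Some a, MoveN) = zipper u [:: a].
Proof. by apply: funext => -[[|n]|n] /=; rewrite ?onth0n. Qed.

Lemma zipper_append u a :
  write_move (zipper u [::]) (Some a, MoveR) = zipper (a :: u) [::].
Proof. by rewrite write_moveE zipper_write zipper_moveR. Qed.

Lemma zipper_erase u a :
  write_move (zipper u [:: a]) (None, MoveN) = zipper u [::].
Proof. by apply: funext => -[[|n]|n] //=; rewrite /write_move /= !onth0n. Qed.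

(* The head is on the top of the stack, or on a blank cell if it is empty. *)
Definition stack_tape u : tape S := move_head MoveL (zipper u [::]).

Lemma stack_tape_scan u : stack_tape u 0 = ohead u.
Proof. by rewrite /stack_tape move_headE; case: u. Qed.

Lemma stack_tape_nil : stack_tape [::] = @blank_tape S.
Proof. by apply: funext => i; rewrite /stack_tape move_headE -blank_zipper. Qed.

Lemma stack_tape_push u a :
  write_move (zipper u [::]) (Some a, MoveN) = stack_tape (a :: u).
Proof. by rewrite zipper_write -zipper_moveL. Qed.

Lemma stack_tape_pop u :
  write_move (stack_tape u) (None, MoveL) = stack_tape (behead u).
Proof.
case: u => [|a u]; rewrite write_moveE; congr (move_head MoveL _).
  apply: funext => i; rewrite stack_tape_nil -blank_zipper /write_move /=.
  by case: eqP.
by rewrite /stack_tape zipper_moveL zipper_erase.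
Qed.

End Tapes.

(** * Pushdown transducers *)

Inductive stack_op (S : Type) := Keep | Push of S | Pop.
Arguments Keep {S}.
Arguments Pop {S}.

Definition update_stack (S : Type) (op : stack_op S) (st : seq S) : seq S :=
  match op with Keep => st | Push a => a :: st | Pop => behead st end.

(* A push takes two steps: this one leaves the head on the blank cell above the
   top, where the symbol is then written. *)
Definition stack_write (S : Type) (op : stack_op S) (top : option S) :
    option S * direction :=
  match op with
  | Keep => (top, MoveN)
  | Push _ => (top, MoveR)
  | Pop => (None, MoveL)
  end.

Lemma stack_tape_write (S : Type) (op : stack_op S) (st : seq S) :
  write_move (stack_tape st) (stack_write op (ohead st)) =
  if op is Push _ then zipper st [::] else stack_tape (update_stack op st).
Proof.
case: op => [|a|] /=; rewrite ?stack_tape_pop // -stack_tape_scan.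
- exact: write_move_id.
- exact: move_headLK.
Qed.

Record action (S Q : Type) := Action {
  next_state : Q;
  emitted : seq S;
  input_move : direction;
  stack_update : stack_op S
}.

(* [pt_delta] is given the symbol scanned on the two-way input and the top of
   the stack; it returns [None] to stop. *)
Record pushdown_transducer (S : finType) := PushdownTransducer {
  pt_state : finType;
  pt_start : pt_state;
  pt_delta : pt_state -> option S -> option S -> option (action S pt_state)
}.

Lemma insub_bseqK (X : Type) n (s : seq X) :
  (size s <= n)%N -> insub_bseq n s = s :> seq X.
Proof. by move=> le_s; rewrite /insub_bseq; apply: insubdK. Qed.

Section Transductions.
Variables (S : finType) (T : pushdown_transducer S).
Implicit Types (q : pt_state T) (a : S) (u v w o st : seq S).
Implicit Types (ti to tw : tape S).

Record pt_config := PtConfig {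
  pc_state : pt_state T;
  pc_input : tape S;
  pc_output : seq S;
  pc_stack : seq S
}.

Definition pt_at q u v o st := PtConfig q (zipper u v) o st.

Definition pt_init w := PtConfig (pt_start T) (word_tape w) [::] [::].

Definition act (x : action S (pt_state T)) (k : pt_config) : pt_config :=
  PtConfig (next_state x) (move_head (input_move x) (pc_input k))
    (pc_output k ++ emitted x) (update_stack (stack_update x) (pc_stack k)).

Definition enabled (k : pt_config) : option (action S (pt_state T)) :=
  pt_delta (pc_state k) (pc_input k 0) (ohead (pc_stack k)).

Inductive reach_within : nat -> pt_config -> pt_config -> Prop :=
  | reach_refl n k : reach_within n k k
  | reach_act n k x k' : enabled k = Some x -> reach_within n (act x k) k' ->
      reach_within n.+1 k k'.

Lemma reach_mono m n k k' :
  (m <= n)%N -> reach_within m k k' -> reach_within n k k'.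
Proof.
move=> + r.
elim: r n => {m k k'} [m k n _|m k x k' enabled_k _ IH [|n] // le_mn].
  exact: reach_refl.
exact: reach_act enabled_k (IH _ le_mn).
Qed.

Lemma reach_trans m n k k' k'' :
  reach_within m k k' -> reach_within n k' k'' -> reach_within (m + n) k k''.
Proof.
elim=> {m k k'} [m k|m k x k' enabled_k _ IH] r.
  exact: reach_mono (leq_addl _ _) r.
exact: reach_act enabled_k (IH r).
Qed.

Lemma reach_actR n q q' w op u a v o st k :
  pt_delta q (Some a) (ohead st) = Some (Action q' w MoveR op) ->
  reach_within n (pt_at q' (a :: u) v (o ++ w) (update_stack op st)) k ->
  reach_within n.+1 (pt_at q u (a :: v) o st) k.
Proof.
move=> delta_q r; apply: (@reach_act _ _ (Action q' w MoveR op)) => //.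
by rewrite /act /= zipper_moveR.
Qed.

Lemma reach_map (h : S -> seq S) q w u v o st :
  {in w, forall a,
    pt_delta q (Some a) (ohead st) = Some (Action q (h a) MoveR Keep)} ->
  reach_within (size w) (pt_at q u (w ++ v) o st)
    (pt_at q (catrev w u) v (o ++ flatten (map h w)) st).
Proof.
elim: w u o => [|a w IH] u o delta_q; first by rewrite cats0; apply: reach_refl.
apply: reach_actR (delta_q _ (mem_head _ _)) _; rewrite catA; apply: IH => b wb.
by apply: delta_q; rewrite inE wb orbT.
Qed.

Lemma reach_copy q w u v o st :
  {in w, forall a,
    pt_delta q (Some a) (ohead st) = Some (Action q [:: a] MoveR Keep)} ->
  reach_within (size w) (pt_at q u (w ++ v) o st)
    (pt_at q (catrev w u) v (o ++ w) st).
Proof. by move=> /reach_map -/(_ u v o); rewrite flatten_seq1. Qed.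

Lemma reach_copy_until stop q q' w u v o st : stop \notin w ->
  (forall a, pt_delta q (Some a) (ohead st) =
    Some (Action (if a == stop then q' else q) [:: a] MoveR Keep)) ->
  reach_within (size (rcons w stop)) (pt_at q u (rcons w stop ++ v) o st)
    (pt_at q' (catrev (rcons w stop) u) v (o ++ rcons w stop) st).
Proof.
move=> stopNw delta_q.
rewrite size_rcons -addn1 cat_rcons -cats1 catrev_catl catA.
apply: reach_trans.
  apply: reach_copy => a a_w; rewrite delta_q; case: eqP => // eq_a.
  by rewrite -eq_a a_w in stopNw.
by apply: reach_actR (delta_q stop) _; rewrite eqxx; apply: reach_refl.
Qed.

(* [move_head MoveL (zipper u v)] has its head on the last letter of [rev u]. *)
Lemma reach_rewind q w u v o st :
  {in w, forall a,
    pt_delta q (Some a) (ohead st) = Some (Action q [::] MoveL Keep)} ->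
  reach_within (size w)
    (PtConfig q (move_head MoveL (zipper (catrev w u) v)) o st)
    (PtConfig q (move_head MoveL (zipper u (w ++ v))) o st).
Proof.
elim/last_ind: w v => [|w a IH] v delta_q; first exact: reach_refl.
rewrite size_rcons -cats1 catrev_catl zipper_moveL.
apply: (@reach_act _ _ (Action q [::] MoveL Keep)).
  by apply: delta_q; rewrite mem_rcons mem_head.
rewrite /act /= cats0 -catA; apply: IH => b wb.
by apply: delta_q; rewrite mem_rcons inE wb orbT.
Qed.

Definition emission_bound :=
  (\max_(x : pt_state T * option S * option S)
     if pt_delta x.1.1 x.1.2 x.2 is Some y then size (emitted y) else 0)%N.

Lemma size_emitted k x :
  enabled k = Some x -> (size (emitted x) <= emission_bound)%N.
Proof.
move=> enabled_k.
have := @leq_bigmax _ (fun y : pt_state T * option S * option S =>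
    if pt_delta y.1.1 y.1.2 y.2 is Some z then size (emitted z) else 0)%N
  (pc_state k, pc_input k 0, ohead (pc_stack k)).
by rewrite /= -/(enabled k) enabled_k.
Qed.

Lemma reach_size_output n k k' : reach_within n k k' ->
  (size (pc_output k') <= size (pc_output k) + n * emission_bound)%N.
Proof.
elim=> {n k k'} [n k|n k x k' /size_emitted le_x _ IH]; first exact: leq_addr.
by apply: leq_trans IH _; rewrite /= size_cat mulSn; lia.
Qed.

(* [inl (q, p, w)] still has to push p and to write w before acting in state q;
   [inr false] brings the output head back to the first letter; [inr true] is
   final. *)
Let machine_state :=
  ((pt_state T * option S * {bseq emission_bound of S}) + bool)%type.

Definition by_tape (X : Type) (i o w : X) (j : tape_id unit) : X :=
  match j with InTape => i | OutTape => o | WorkTape _ => w end.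

Definition pushed (op : stack_op S) := if op is Push a then Some a else None.

Definition machine_trans (s : machine_state) (rd : tape_id unit -> option S) :
    machine_state * (tape_id unit -> option S * direction) :=
  let move d j := (rd j, d) in
  let stay := move MoveN in
  let move_output d :=
    by_tape (stay InTape) (move d OutTape) (stay (WorkTape tt)) in
  match s with
  | inl (q, Some a, w) =>
    (inl (q, None, w), by_tape (stay InTape) (stay OutTape) (Some a, MoveN))
  | inl (q, None, w) =>
    if bseqval w is a :: w' then
      (inl (q, None, insub_bseq emission_bound w'),
       by_tape (stay InTape) (Some a, MoveR) (stay (WorkTape tt)))
    else if pt_delta q (rd InTape) (rd (WorkTape tt)) is Some x then
      (inl (next_state x, pushed (stack_update x),
            insub_bseq emission_bound (emitted x)),
       by_tape (move (input_move x) InTape) (stay OutTape)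
         (stack_write (stack_update x) (rd (WorkTape tt))))
    else (inr false, move_output MoveL)
  | inr _ =>
    if rd OutTape is Some _ then (inr false, move_output MoveL)
    else (inr true, move_output MoveR)
  end.

Definition pt_machine : TM S S :=
  @MkTM S S machine_state S unit id (@inj_id _) id (@inj_id _)
    (inl (pt_start T, None, insub_bseq emission_bound [::]))
    (fun s => if s is inr b then b else false) machine_trans.

Let step := @tm_step _ _ pt_machine.

Definition machine_config (s : machine_state) (ti to tw : tape S) :
    config pt_machine :=
  @MkConfig _ _ pt_machine s (by_tape ti to tw).

Lemma machine_step s ti to tw : ~~ tm_halt (s : tm_state pt_machine) ->
  let x := machine_trans s (by_tape (ti 0) (to 0) (tw 0)) in
  step (machine_config s ti to tw) =
  machine_config x.1 (write_move ti (x.2 InTape)) (write_move to (x.2 OutTape))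
    (write_move tw (x.2 (WorkTape tt))).
Proof.
move=> running /=; rewrite /step /tm_step (negPf running) /=.
have -> : (fun j => by_tape ti to tw j 0) = by_tape (ti 0) (to 0) (tw 0).
  by apply: funext => -[].
by congr MkConfig; apply: funext => -[||[]].
Qed.

Definition pending q p w : machine_state :=
  inl (q, p, insub_bseq emission_bound w).

Definition machine_of (k : pt_config) : config pt_machine :=
  machine_config (pending (pc_state k) None [::]) (pc_input k)
    (zipper (rev (pc_output k)) [::]) (stack_tape (pc_stack k)).

Lemma machine_emit q w ti o tw : (size w <= emission_bound)%N ->
  iter (size w) step
    (machine_config (pending q None w) ti (zipper (rev o) [::]) tw) =
  machine_config (pending q None [::]) ti (zipper (rev (o ++ w)) [::]) tw.
Proof.
elim: w o => [|a w IH] o le_w; first by rewrite cats0.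
rewrite iterSr machine_step //= insub_bseqK //= !write_move_id.
by rewrite zipper_append -rev_rcons IH ?(ltnW le_w) // cat_rcons.
Qed.

Lemma machine_act k x : enabled k = Some x ->
  exists2 m, (m <= emission_bound + 2)%N &
    iter m step (machine_of k) = machine_of (act x k).
Proof.
case: k => q ti o st enabled_x.
have le_x := size_emitted enabled_x; move: enabled_x.
case: x le_x => q' w d op /= le_w; rewrite /enabled /= => enabled_x.
have emit tw := machine_emit q' (move_head d ti) o tw le_w.
have act_step : step (machine_of (PtConfig q ti o st)) =
  machine_config (pending q' (pushed op) w) (move_head d ti)
    (zipper (rev o) [::])
    (if op is Push _ then zipper st [::] else stack_tape (update_stack op st)).
  by rewrite machine_step //= insub_bseqK //= stack_tape_scan enabled_x /=
    write_move_id stack_tape_write.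
case: op act_step {enabled_x} => [|a|] /= act_step.
- by exists (size w).+1; [lia | rewrite iterSr act_step emit].
- exists (size w).+2; first lia.
  rewrite !iterSr act_step machine_step //= !write_move_id.
  by rewrite stack_tape_push emit.
- by exists (size w).+1; [lia | rewrite iterSr act_step emit].
Qed.

Lemma machine_reach n k k' : reach_within n k k' ->
  exists2 m, (m <= n * (emission_bound + 2))%N &
    iter m step (machine_of k) = machine_of k'.
Proof.
elim=> {n k k'} [n k|n k x k' /machine_act [m le_m em] _ [m' le_m' em']].
  by exists 0%N.
exists (m' + m)%N; last by rewrite iterD em.
by rewrite mulSn addnC leq_add.
Qed.

Lemma machine_rewind ti u v tw :
  iter (size u).+1 step
    (machine_config (inr false) ti (move_head MoveL (zipper u v)) tw) =
  machine_config (inr true) ti (zipper [::] (catrev u v)) tw.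
Proof.
elim: u v => [|a u IH] v; rewrite iterSr machine_step //=.
  have blank : move_head MoveL (zipper [::] v) 0 = None by rewrite move_headE.
  rewrite blank /= -[X in (X, MoveR)]blank !write_move_id.
  by rewrite -/(move_head MoveR _) move_headLK.
by rewrite zipper_moveL /= !write_move_id -IH.
Qed.

Lemma machine_stop k : enabled k = None ->
  iter (size (pc_output k)).+2 step (machine_of k) =
  machine_config (inr true) (pc_input k) (word_tape (pc_output k))
    (stack_tape (pc_stack k)).
Proof.
case: k => q ti o st; rewrite /enabled [pc_state _]/= [pc_input _]/= => stop.
rewrite word_zipper -[X in zipper _ X]revK -machine_rewind size_rev iterSr.
congr (iter _ _ _); rewrite machine_step //= insub_bseqK //=.
by rewrite stack_tape_scan stop /= -stack_tape_scan !write_move_id.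
Qed.

Lemma machine_outputs n w k :
  reach_within n (pt_init w) k -> enabled k = None ->
  outputs_within pt_machine w (pc_output k) (n * (emission_bound + 2).*2 + 2).
Proof.
move=> r stop; have [m le_m em] := machine_reach r.
have le_out := reach_size_output r.
apply: (@outputs_within_mono _ _ _ _ _ ((size (pc_output k)).+2 + m)%N).
  by move: le_out; rewrite /= add0n; nia.
have init : init_config pt_machine w = machine_of (pt_init w).
  rewrite /init_config /machine_of /machine_config; congr MkConfig.
  apply: funext => -[||[]] /=.
  - by rewrite map_id.
  - by rewrite -blank_zipper.
  - by rewrite stack_tape_nil.
rewrite /outputs_within init iterD em machine_stop //=.
by rewrite map_id.
Qed.

End Transductions.

Definition transduces (S : finType) (T : pushdown_transducer S) (c : nat)
    (w v : seq S) :=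
  exists k, [/\ reach_within (c * (size w).+1) (pt_init T w) k,
                enabled k = None & pc_output k = v].

Lemma transduces_polytime (S : finType) (I J : Type)
    (encI : I -> seq S) (encJ : J -> seq S)
    (injI : injective encI) (injJ : injective encJ)
    (yesI : I -> Prop) (yesJ : J -> Prop) (f : I -> J)
    (T : pushdown_transducer S) c :
  (forall x, transduces T c (encI x) (encJ (f x))) ->
  @polytime_computable (MkProblem injI yesI) (MkProblem injJ yesJ) f.
Proof.
move=> tf; apply/polytime_computableP.
exists (pt_machine T), (c * (emission_bound T + 2).*2 + 2)%N, 1%N => x /=.
have [k [r stop <-]] := tf x.
apply: outputs_within_mono (machine_outputs r stop).
by rewrite expn1 mulnDl -!mulnA [X in (c * X)%N]mulnC leq_add2l leq_pmulr.
Qed.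

Section Substitution.
Variables (S : finType) (h : S -> seq S).

Definition subst_transducer : pushdown_transducer S :=
  PushdownTransducer tt
    (fun q a _ => omap (fun s => Action q (h s) MoveR Keep) a).

Lemma subst_transduces w : transduces subst_transducer 1 w (flatten (map h w)).
Proof.
have := @reach_map _ subst_transducer h tt w [::] [::] [::] [::]
  (fun _ _ => erefl).
rewrite cats0 => r.
exists (@pt_at _ subst_transducer tt (catrev w [::]) [::]
  (flatten (map h w)) [::]).
split=> //; rewrite /pt_init word_zipper.
by apply: reach_mono r; rewrite mul1n.
Qed.

End Substitution.

(** * Shifting comparisons by a constant *)

Definition spoly_addC q (c : rat) (p : spoly q) : spoly q := (c, [::]) :: p.

Lemma spoly_eval_addC (R : realType) q (x : 'I_q -> R) c (p : spoly q) :
  spoly_eval x (spoly_addC c p) = spoly_eval x p + ratr c.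
Proof.
rewrite addrC /spoly_eval /mpoly_of big_cons /= big_nil rmorphD /= mevalD.
by rewrite -mul_mpolyC mulr1 map_mpolyC mevalC.
Qed.

Definition const_word (c : rat) := SPlus :: enc_rat c ++ [:: SMonEnd].

Lemma enc_spoly_addC q c (p : spoly q) :
  enc_spoly (spoly_addC c p) = const_word c ++ enc_spoly p.
Proof. by rewrite /enc_spoly /= /enc_term /= -!catA. Qed.

Definition eps_shift (V : zmodType) (eps : V) (r : eps_cmp) : V :=
  match r with LtE | LeE => eps | GeE | GtE => - eps end.

Lemma ratr_eps_shift (R : realType) (eps : rat) r :
  ratr (eps_shift eps r) = eps_shift (ratr eps) r :> R.
Proof. by case: r; rewrite /= ?rmorphN. Qed.

Definition exact_cmp (r : eps_cmp) : cmp :=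
  match r with LtE => CLt | LeE => CLe | GeE => CGe | GtE => CGt end.

Lemma eps_cmp_holdsE (R : realType) (eps : R) r a b :
  eps_cmp_holds eps r a b = cmp_holds (exact_cmp r) (a - eps_shift eps r) b.
Proof. by case: r; rewrite /= ?opprK (ltrBlDr, lerBlDr). Qed.

(** * Words of formulas *)

Definition poly_symbol (s : symbol) := (symbol_code s < symbol_code SPolyEnd)%N.

Lemma enc_nat_rcons n :
  exists2 w, enc_nat n = rcons w SNumEnd & {subset w <= [:: SBit0; SBit1]}.
Proof.
rewrite /enc_nat; case: (bin_of_nat n) => [|p]; first by exists [::].
exists (pos_bits p); rewrite ?cats1 //; apply/allP.
by elim: p.
Qed.

Lemma enc_nat_poly n : all poly_symbol (enc_nat n).
Proof.
have [w -> bits] := enc_nat_rcons n; rewrite all_rcons /=.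
by apply/allP => s /bits; rewrite !inE => /orP[] /eqP ->.
Qed.

Lemma enc_rat_poly c : all poly_symbol (enc_rat c).
Proof.
rewrite /enc_rat all_cat enc_nat_poly /enc_int all_cat enc_nat_poly.
by case: ifP.
Qed.

Lemma enc_seq_rcons (P : pred symbol) (T : Type) (item stop : symbol)
    (enc : T -> seq symbol) (s : seq T) :
  P item -> (forall x, all P (enc x)) ->
  exists2 w, enc_seq item stop enc s = rcons w stop & all P w.
Proof.
move=> P_item P_enc; elim: s => [|x s [w e P_w]]; first by exists [::].
exists (item :: enc x ++ w); rewrite /= ?e ?rcons_cat //.
by rewrite P_item all_cat P_enc.
Qed.

Lemma enc_term_poly q (t : rat * monom q) : all poly_symbol (enc_term t).
Proof.
rewrite /enc_term all_cat enc_rat_poly.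
have [|v|w -> P_w] :=
  @enc_seq_rcons poly_symbol _ STimes SMonEnd (@enc_factor q) t.2 => //.
  by rewrite /enc_factor all_cat !enc_nat_poly.
by rewrite all_rcons P_w.
Qed.

Lemma enc_spoly_rcons q (p : spoly q) :
  exists2 w, enc_spoly p = rcons w SPolyEnd & all poly_symbol w.
Proof. by apply: enc_seq_rcons => // t; apply: enc_term_poly. Qed.

Definition cmp_of_symbol (s : symbol) : option cmp :=
  match s with
  | SLt => Some CLt | SLe => Some CLe | SEq => Some CEq
  | SGe => Some CGe | SGt => Some CGt | _ => None
  end.

Definition eps_cmp_of_symbol (s : symbol) : option eps_cmp :=
  match s with
  | SLt => Some LtE | SLe => Some LeE | SGe => Some GeE | SGt => Some GtE
  | _ => None
  end.

Lemma enc_eps_cmpK : pcancel enc_eps_cmp eps_cmp_of_symbol.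
Proof. by case. Qed.

(** * From eps-ETR to ETR *)

Section EpsToETR.
Variable eps : rat.

Fixpoint exact_formula q (F : eps_formula q) : formula q :=
  match F with
  | EAtom r p p' => FAtom (exact_cmp r) (spoly_addC (- eps_shift eps r) p) p'
  | EAnd F1 F2 => FAnd (exact_formula F1) (exact_formula F2)
  | EOr F1 F2 => FOr (exact_formula F1) (exact_formula F2)
  end.

Lemma holds_exact (R : realType) q (x : 'I_q -> R) (F : eps_formula q) :
  holds x (exact_formula F) <-> eps_holds (ratr eps) x F.
Proof.
elim: F => [r p p'|F1 IH1 F2 IH2|F1 IH1 F2 IH2] /=; rewrite ?IH1 ?IH2 //.
by rewrite spoly_eval_addC rmorphN /= ratr_eps_shift eps_cmp_holdsE.
Qed.

Definition exact_word (s : symbol) : seq symbol :=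
  s :: if eps_cmp_of_symbol s is Some r then const_word (- eps_shift eps r)
       else [::].

Lemma exact_word_poly w : all poly_symbol w -> flatten (map exact_word w) = w.
Proof. by elim: w => //= s w IH /andP[+ /IH ->]; case: s. Qed.

Lemma exact_word_spoly q (p : spoly q) :
  flatten (map exact_word (enc_spoly p)) = enc_spoly p.
Proof.
have [w -> poly_w] := enc_spoly_rcons p.
by rewrite map_rcons flatten_rcons exact_word_poly // cats1.
Qed.

Lemma enc_exact_formula q (F : eps_formula q) :
  flatten (map exact_word (enc_eps_formula F)) = enc_formula (exact_formula F).
Proof.
elim: F => [r p p'|F1 IH1 F2 IH2|F1 IH1 F2 IH2].
- rewrite -[RHS]/(_ :: enc_spoly (spoly_addC _ p) ++ _) enc_spoly_addC.
  rewrite /= map_cat flatten_cat !exact_word_spoly enc_eps_cmpK -catA.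
  by case: r.
- by rewrite /= map_cat flatten_cat IH1 IH2.
- by rewrite /= map_cat flatten_cat IH1 IH2.
Qed.

Definition exact_instance (I : eps_etr_instance) : etr_instance :=
  existT formula (tag I) (exact_formula (tagged I)).

Lemma enc_exact_instance I :
  enc_etr (exact_instance I) = flatten (map exact_word (enc_eps_etr I)).
Proof.
rewrite /enc_eps_etr map_cat flatten_cat enc_exact_formula exact_word_poly //.
exact: enc_nat_poly.
Qed.

Lemma eps_etr_reduces_to_etr (R : realType) :
  polytime_reducible (EpsETR R eps) (ETR R).
Proof.
exists exact_instance; split; last first.
  by move=> I; split=> -[x Fx]; exists x; apply/holds_exact.
have exact_transduces I : transduces (subst_transducer exact_word) 1
    (enc_eps_etr I) (enc_etr (exact_instance I)).
  by rewrite enc_exact_instance; apply: subst_transduces.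
exact: transduces_polytime exact_transduces.
Qed.

End EpsToETR.

(** * From ETR to eps-ETR *)

(* Only equalities need two comparisons, but both are used for every atom: this
   keeps the control of the transducer uniform. *)
Definition first_cmp (r : cmp) : eps_cmp :=
  match r with
  | CLt => LtE | CLe | CEq => LeE | CGe => GeE | CGt => GtE
  end.

Definition second_cmp (r : cmp) : eps_cmp :=
  match r with
  | CLt => LtE | CLe => LeE | CEq | CGe => GeE | CGt => GtE
  end.

(* The boolean [neg] is the parity of the number of enclosing negations. *)
Definition polar_cmp (neg : bool) (r : eps_cmp) : eps_cmp :=
  if neg then match r with LtE => GeE | LeE => GtE | GeE => LtE | GtE => LeE end
  else r.

Definition polar_and (neg : bool) q (F1 F2 : eps_formula q) :=
  if neg then EOr F1 F2 else EAnd F1 F2.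

Section NegationNormalForm.
Variable eps : rat.

Definition eps_atom q r (p p' : spoly q) :=
  EAtom r (spoly_addC (eps_shift eps r) p) p'.

Fixpoint nnf (neg : bool) q (F : formula q) : eps_formula q :=
  match F with
  | FAtom r p p' =>
    polar_and neg (eps_atom (polar_cmp neg (first_cmp r)) p p')
                  (eps_atom (polar_cmp neg (second_cmp r)) p p')
  | FAnd F1 F2 => polar_and neg (nnf neg F1) (nnf neg F2)
  | FOr F1 F2 => polar_and (~~ neg) (nnf neg F1) (nnf neg F2)
  | FNot F1 => nnf (~~ neg) F1
  end.

Section Semantics.
Variables (R : realType) (q : nat) (x : 'I_q -> R).

Lemma holds_eps_atom r (p p' : spoly q) :
  eps_holds (ratr eps) x (eps_atom r p p') <->
  cmp_holds (exact_cmp r) (spoly_eval x p) (spoly_eval x p').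
Proof. by rewrite /= spoly_eval_addC eps_cmp_holdsE ratr_eps_shift addrK. Qed.

Lemma holds_polar_and neg (F1 F2 : eps_formula q) :
  eps_holds (ratr eps) x (polar_and neg F1 F2) <->
  if neg then eps_holds (ratr eps) x F1 \/ eps_holds (ratr eps) x F2
  else eps_holds (ratr eps) x F1 /\ eps_holds (ratr eps) x F2.
Proof. by case: neg. Qed.

Lemma first_second_cmp r (a b : R) :
  cmp_holds (exact_cmp (first_cmp r)) a b &&
  cmp_holds (exact_cmp (second_cmp r)) a b = cmp_holds r a b.
Proof. by case: r => /=; rewrite ?andbb // -eq_le. Qed.

Lemma polar_cmp_holds neg r (a b : R) :
  cmp_holds (exact_cmp (polar_cmp neg r)) a b =
  neg (+) cmp_holds (exact_cmp r) a b.
Proof. by case: neg; case: r => /=; rewrite ?leNgt ?ltNge ?negbK. Qed.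

Lemma holds_nnf neg (F : formula q) :
  eps_holds (ratr eps) x (nnf neg F) <-> if neg then ~ holds x F else holds x F.
Proof.
elim: F neg => [r p p'|F1 IH1 F2 IH2|F1 IH1 F2 IH2|F1 IH1] neg.
- rewrite holds_polar_and [holds _ _]/= -first_second_cmp.
  case: neg; rewrite !holds_eps_atom !polar_cmp_holds.
    by rewrite (rwP orP) (rwP negP) negb_and.
  by rewrite (rwP andP).
- by rewrite holds_polar_and; case: neg; rewrite IH1 IH2 //= not_andP.
- by rewrite holds_polar_and; case: neg; rewrite /= IH1 IH2 //= not_orP.
- by rewrite /= IH1; case: neg; rewrite /= ?notK.
Qed.

End Semantics.

Definition nnf_instance (I : etr_instance) : eps_etr_instance :=
  existT eps_formula (tag I) (nnf false (tagged I)).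

Definition polar_and_symbol (neg : bool) := if neg then SOr else SAnd.

Lemma enc_polar_and neg q (F1 F2 : eps_formula q) :
  enc_eps_formula (polar_and neg F1 F2) =
  polar_and_symbol neg :: enc_eps_formula F1 ++ enc_eps_formula F2.
Proof. by case: neg. Qed.

Definition atom_prefix (r : eps_cmp) :=
  enc_eps_cmp r :: const_word (eps_shift eps r).

Lemma enc_eps_atom q r (p p' : spoly q) :
  enc_eps_formula (eps_atom r p p') =
  atom_prefix r ++ enc_spoly p ++ enc_spoly p'.
Proof.
by rewrite -[LHS]/(_ :: enc_spoly (spoly_addC _ p) ++ _) enc_spoly_addC -catA.
Qed.

End NegationNormalForm.

(* [ReadFormula neg] is about to read a formula of polarity [neg], and
   [NextFormula] takes from the stack the polarity of the next pending right
   subformula.  [CopyLhs o] and [CopyRhs o] copy the operands of an atom; if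
   [o = Some neg], then [Rewind neg] brings the head back to the comparison
   symbol for a second copy. *)
Inductive nnf_state :=
  | ReadArity
  | ReadFormula of bool
  | CopyLhs of option bool
  | CopyRhs of option bool
  | Rewind of bool
  | NextFormula.

Definition nnf_state_code (q : nnf_state) :
    option bool + (option bool + option bool) + option bool :=
  match q with
  | ReadArity => inl (inl None)
  | ReadFormula neg => inl (inl (Some neg))
  | CopyLhs o => inl (inr (inl o))
  | CopyRhs o => inl (inr (inr o))
  | Rewind neg => inr (Some neg)
  | NextFormula => inr None
  end.

Definition nnf_state_decode
    (s : option bool + (option bool + option bool) + option bool) : nnf_state :=
  match s with
  | inl (inl o) => if o is Some neg then ReadFormula neg else ReadArity
  | inl (inr (inl o)) => CopyLhs o
  | inl (inr (inr o)) => CopyRhs o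
  | inr o => if o is Some neg then Rewind neg else NextFormula
  end.

Lemma nnf_state_codeK : cancel nnf_state_code nnf_state_decode.
Proof. by case. Qed.

HB.instance Definition _ := Finite.copy nnf_state (can_type nnf_state_codeK).

Section NnfTransducer.
Variable eps : rat.

Definition bit (b : bool) := if b then SBit1 else SBit0.

Definition nnf_delta (q : nnf_state) (s top : option symbol) :
    option (action symbol nnf_state) :=
  match q, s with
  | NextFormula, _ =>
    omap (fun a => Action (ReadFormula (a == SBit1)) [::] MoveN Pop) top
  | _, None => None
  | ReadArity, Some a =>
    Some (Action (if a == SNumEnd then ReadFormula false else ReadArity)
            [:: a] MoveR Keep)
  | ReadFormula neg, Some a =>
    match a with
    | SNot => Some (Action (ReadFormula (~~ neg)) [::] MoveR Keep)
    | SAnd => Some (Action (ReadFormula neg) [:: polar_and_symbol neg] MoveR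
                      (Push (bit neg)))
    | SOr => Some (Action (ReadFormula neg) [:: polar_and_symbol (~~ neg)] MoveR
                     (Push (bit neg)))
    | _ =>
      omap (fun r =>
        Action (CopyLhs (Some neg))
          (polar_and_symbol neg ::
             atom_prefix eps (polar_cmp neg (first_cmp r)))
          MoveR Keep) (cmp_of_symbol a)
    end
  | CopyLhs o, Some a =>
    Some (Action (if a == SPolyEnd then CopyRhs o else q) [:: a] MoveR Keep)
  | CopyRhs None, Some a =>
    Some (Action (if a == SPolyEnd then NextFormula else q) [:: a] MoveR Keep)
  | CopyRhs (Some neg), Some a =>
    Some (if a == SPolyEnd then Action (Rewind neg) [:: a] MoveL Keep
          else Action q [:: a] MoveR Keep)
  | Rewind neg, Some a =>
    Some (if cmp_of_symbol a is Some r then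
            Action (CopyLhs None)
              (atom_prefix eps (polar_cmp neg (second_cmp r))) MoveR Keep
          else Action q [::] MoveL Keep)
  end.

Definition nnf_transducer : pushdown_transducer symbol :=
  PushdownTransducer ReadArity nnf_delta.

Implicit Types (u v w o st : seq symbol).

Local Notation nnf_at := (@pt_at _ nnf_transducer).

Definition translates neg w w' := forall u v o st,
  reach_within (3 * size w) (nnf_at (ReadFormula neg) u (w ++ v) o st)
    (nnf_at NextFormula (catrev w u) v (o ++ w') st).

Lemma reach_copy_arity k u v o st :
  reach_within (size (enc_nat k)) (nnf_at ReadArity u (enc_nat k ++ v) o st)
    (nnf_at (ReadFormula false) (catrev (enc_nat k) u) v (o ++ enc_nat k) st).
Proof.
have [w -> bits_w] := enc_nat_rcons k.
by apply: (@reach_copy_until _ nnf_transducer) => //; apply/negP => /bits_w.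
Qed.

Lemma reach_copy_poly k (p : spoly k) q q' u v o st :
  (forall a, nnf_delta q (Some a) (ohead st) =
    Some (Action (if a == SPolyEnd then q' else q) [:: a] MoveR Keep)) ->
  reach_within (size (enc_spoly p)) (nnf_at q u (enc_spoly p ++ v) o st)
    (nnf_at q' (catrev (enc_spoly p) u) v (o ++ enc_spoly p) st).
Proof.
have [w -> poly_w] := enc_spoly_rcons p.
by apply: (@reach_copy_until _ nnf_transducer); apply/negP => /(allP poly_w).
Qed.

Lemma nnf_delta_rewind neg k (p : spoly k) a top : a \in enc_spoly p ->
  nnf_delta (Rewind neg) (Some a) top =
  Some (Action (Rewind neg) [::] MoveL Keep).
Proof.
have [w -> poly_w] := enc_spoly_rcons p; rewrite mem_rcons inE.
by case/orP=> [/eqP -> //|/(allP poly_w)]; case: a.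
Qed.

Lemma reach_copy_rewind k (p p' : spoly k) neg r u v o st :
  reach_within (size (enc_spoly p') + size (enc_spoly p ++ enc_spoly p'))
    (nnf_at (CopyRhs (Some neg)) (catrev (enc_spoly p) (enc_cmp r :: u))
      (enc_spoly p' ++ v) o st)
    (nnf_at (Rewind neg) u (enc_cmp r :: (enc_spoly p ++ enc_spoly p') ++ v)
      (o ++ enc_spoly p') st).
Proof.
have [w' enc_p' poly_w'] := enc_spoly_rcons p'.
set w := enc_spoly p ++ w'.
have copy : reach_within (size w')
    (nnf_at (CopyRhs (Some neg)) (catrev (enc_spoly p) (enc_cmp r :: u))
      (w' ++ SPolyEnd :: v) o st)
    (nnf_at (CopyRhs (Some neg)) (catrev w (enc_cmp r :: u)) (SPolyEnd :: v)
      (o ++ w') st).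
  rewrite catrev_catl; apply: (@reach_copy _ nnf_transducer) => a.
  by move/(allP poly_w'); case: a.
have rewind : reach_within (size w)
    (PtConfig (T := nnf_transducer) (Rewind neg)
      (move_head MoveL (zipper (catrev w (enc_cmp r :: u)) (SPolyEnd :: v)))
      (o ++ rcons w' SPolyEnd) st)
    (nnf_at (Rewind neg) u (enc_cmp r :: w ++ SPolyEnd :: v)
      (o ++ rcons w' SPolyEnd) st).
  rewrite /pt_at -(zipper_moveL u).
  apply: (@reach_rewind _ nnf_transducer) => a.
  rewrite mem_cat => /orP[a_p|a_w'].
    exact: nnf_delta_rewind a_p.
  apply: (@nnf_delta_rewind neg _ p').
  by rewrite enc_p' mem_rcons inE a_w' orbT.
rewrite enc_p' -rcons_cat -/w !cat_rcons.
apply: (@reach_mono _ _ (size w' + (size w).+1)).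
  by rewrite !size_rcons leq_add.
apply: reach_trans copy _.
apply: (reach_act (T := nnf_transducer)
  (x := Action (Rewind neg) [:: SPolyEnd] MoveL Keep)) => //.
by rewrite /act /= -catA cats1.
Qed.

Lemma nnf_delta_first_cmp neg r top :
  nnf_delta (ReadFormula neg) (Some (enc_cmp r)) top =
  Some (Action (CopyLhs (Some neg))
    (polar_and_symbol neg :: atom_prefix eps (polar_cmp neg (first_cmp r)))
    MoveR Keep).
Proof. by case: r. Qed.

Lemma nnf_delta_second_cmp neg r top :
  nnf_delta (Rewind neg) (Some (enc_cmp r)) top =
  Some (Action (CopyLhs None) (atom_prefix eps (polar_cmp neg (second_cmp r)))
    MoveR Keep).
Proof. by case: r. Qed.

Lemma translates_atom neg k r (p p' : spoly k) :
  translates neg (enc_formula (FAtom r p p'))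
    (enc_eps_formula (nnf eps neg (FAtom r p p'))).
Proof.
move=> u v o st.
rewrite [enc_formula _]/= [nnf _ _ _]/= enc_polar_and !enc_eps_atom.
set w := enc_spoly p; set w' := enc_spoly p'.
set first_prefix := atom_prefix _ _; set second_prefix := atom_prefix _ _.
apply: (@reach_mono _ _
  (size w + (size w' + size (w ++ w') + (size w + size w').+1)).+1).
  by rewrite /= size_cat; lia.
rewrite cat_cons -(catA w w' v).
apply: (reach_actR (T := nnf_transducer) (nnf_delta_first_cmp _ _ _)).
apply: reach_trans.
  by apply: (reach_copy_poly p (q := CopyLhs (Some neg))).
apply: reach_trans.
  exact: reach_copy_rewind.
apply: (reach_actR (T := nnf_transducer) (nnf_delta_second_cmp _ _ _)).
rewrite -(catA w w' v); apply: reach_trans.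
  by apply: (reach_copy_poly p (q := CopyLhs None)).
have := @reach_copy_poly _ p' (CopyRhs None) NextFormula
  (catrev w (enc_cmp r :: u)) v
  (o ++ polar_and_symbol neg :: first_prefix ++ w ++ w' ++ second_prefix ++ w)
  st (fun _ => erefl).
rewrite -/w -/w' -/first_prefix -/second_prefix -catrev_catl.
move: w w' first_prefix second_prefix => w w' first_prefix second_prefix.
by rewrite -!catA !cat_cons -!catA.
Qed.

Lemma translates_connective neg neg' a w1 w2 w1' w2' :
  (forall top, nnf_delta (ReadFormula neg) (Some a) top =
    Some (Action (ReadFormula neg) [:: polar_and_symbol neg'] MoveR
            (Push (bit neg)))) ->
  translates neg w1 w1' -> translates neg w2 w2' ->
  translates neg (a :: w1 ++ w2) (polar_and_symbol neg' :: w1' ++ w2').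
Proof.
move=> delta_a tr_w1 tr_w2 u v o st.
apply: (@reach_mono _ _ (3 * size w1 + (3 * size w2).+1).+1).
  by rewrite /= size_cat; lia.
rewrite cat_cons -(catA w1).
apply: (reach_actR (T := nnf_transducer) (delta_a _)).
apply: reach_trans (tr_w1 _ _ _ _) _.
apply: (reach_act (T := nnf_transducer)
  (x := Action (ReadFormula neg) [::] MoveN Pop)).
  by rewrite /enabled /=; case: (neg).
rewrite /act /= /move_head write_move_id cats0.
have := tr_w2 (catrev w1 (a :: u)) v (o ++ polar_and_symbol neg' :: w1') st.
by rewrite -catrev_catl -!catA.
Qed.

Lemma translates_not neg w w' :
  translates (~~ neg) w w' -> translates neg (SNot :: w) w'.
Proof.
move=> tr_w u v o st; rewrite /= mulnS.
apply: (@reach_mono _ _ (3 * size w).+1); first by lia.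
apply: (reach_actR (T := nnf_transducer) (q := ReadFormula neg)); first by [].
by rewrite cats0; apply: tr_w.
Qed.

Lemma translates_formula neg k (F : formula k) :
  translates neg (enc_formula F) (enc_eps_formula (nnf eps neg F)).
Proof.
elim: F neg => [r p p'|F1 IH1 F2 IH2|F1 IH1 F2 IH2|F1 IH1] neg.
- exact: translates_atom.
- by rewrite [nnf _ _ _]/= enc_polar_and; apply: translates_connective.
- by rewrite [nnf _ _ _]/= enc_polar_and; apply: translates_connective.
- exact/translates_not/IH1.
Qed.

Lemma nnf_transduces I :
  transduces nnf_transducer 3 (enc_etr I) (enc_eps_etr (nnf_instance eps I)).
Proof.
case: I => k F; rewrite /enc_etr /enc_eps_etr /=.
exists (nnf_at NextFormula (catrev (enc_nat k ++ enc_formula F) [::]) [::]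
  (enc_nat k ++ enc_eps_formula (nnf eps false F)) [::]); split=> //.
apply: (@reach_mono _ _ (size (enc_nat k) + 3 * size (enc_formula F))).
  by rewrite (size_cat (enc_nat k)); lia.
rewrite /pt_init word_zipper; apply: reach_trans (reach_copy_arity _ _ _ _ _) _.
have := @translates_formula false k F (catrev (enc_nat k) [::]) [::]
  (enc_nat k) [::].
by rewrite cats0 -catrev_catl.
Qed.

Lemma etr_reduces_to_eps_etr (R : realType) :
  polytime_reducible (ETR R) (EpsETR R eps).
Proof.
exists (nnf_instance eps); split; last first.
  by move=> I; split=> -[x Fx]; exists x; apply/(holds_nnf eps x false).
exact: transduces_polytime nnf_transduces.
Qed.

End NnfTransducer.

Theorem theorem2 (R : realType) (eps : rat) (eps_ge0 : 0 <= eps) :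
  (polytime_reducible (EpsETR R eps) (ETR R) /\
   polytime_reducible (ETR R) (EpsETR R eps)) /\
  (forall P : problem, class_of (EpsETR R eps) P <-> class_of (ETR R) P).
Proof.
have eps_etr := eps_etr_reduces_to_etr eps R.
have etr_eps := etr_reduces_to_eps_etr eps R.
by split=> // P; split=> P_red; apply: polytime_reducible_trans P_red _.
Qed.
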